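(* Let $r=\sqrt[3]{1/4}$, $\alpha_1=\frac{3\sqrt3\,r}{2-3r}$, $\alpha_2=-\frac{\sqrt3\left[(3r+2)^2+4\right]}{2(3r-2)^2}$, and for $a\in[0,1]$ let $\zeta(a)=\exp\left[i\left(\frac{\pi}{3}+\alpha_1a+\alpha_2a^2\right)\right]$ and $$p_a(z)=(z-a)(z+1)\left[z-\zeta(a)\right]\left[z-\overline{\zeta(a)}\right]\in S_4.$$ Then for all sufficiently small $a>0$ one has $\Delta(p_a,z^4+z)=\mathcal{O}(a)$ and $$d(p_a)=|p_a|_a=r+Ca^2+\mathcal{O}(a^3),\qquad\text{where } C=\frac{3}{4r(2-3r)}\ (\approx 10.81154938).$$ In particular, the polynomial $z^4+z$ is not locally maximal for Sendov's conjecture.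
   Context: $S_n$ is the set of monic complex polynomials of degree $n$ with all zeros in the closed unit disk, and $Z(p)$ denotes the zero set of $p$. For $\alpha\in\mathbb{C}$, $|p|_\alpha=\min_{w\in Z(p')}|\alpha-w|$, and $d(p)=\max_{z\in Z(p)}|p|_z$. For monic $p(z)=\prod_{i=1}^n(z-z_i)$ and $q(z)=\prod_{i=1}^n(z-\zeta_i)$, $\Delta(p,q)=\min_{\sigma\in\Sigma_n}\max_{1\le i\le n}|z_i-\zeta_{\sigma(i)}|$, where $\Sigma_n$ is the symmetric group. A polynomial $p\in S_n$ is locally maximal for Sendov's conjecture if there exists $\varepsilon>0$ such that $d(q)\le d(p)$ for all $q\in S_n$ with $\Delta(q,p)<\varepsilon$. The $\mathcal{O}$-terms refer to $a\to0^+$. *)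

(* Defs.v *)
From HB Require Import structures.
From mathcomp Require Import all_boot all_order all_algebra all_fingroup.
From mathcomp Require Import complex.
From mathcomp Require Import all_classical all_reals all_analysis.

Set Implicit Arguments.
Unset Strict Implicit.
Unset Printing Implicit Defensive.

Import Order.TTheory GRing.Theory Num.Theory.
Import numFieldNormedType.Exports.

Local Open Scope classical_set_scope.
Local Open Scope ring_scope.

(* The complex numbers are [R[i]] for an arbitrary realType
   [R]; distances are measured with [Normc.normc], the modulus with values in
   [R] (whereas [`|z|] has values in [R[i]]). *)

Definition zeros (R : realType) (p : {poly R[i]}) : set R[i] :=
  [set z | root p z].

Definition S_class (R : realType) (n : nat) : set {poly R[i]} :=
  [set p | [/\ p \is monic, size p = n.+1 & forall z, zeros p z -> `|z| <= 1]].

(* Every set under [inf] or [sup] in this file is finite, and nonempty as soon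
   as the degree is at least 2, so that [inf] is a minimum and [sup] a
   maximum. *)

Definition crit_dist (R : realType) (p : {poly R[i]}) (alpha : R[i]) : R :=
  inf [set Normc.normc (alpha - w) | w in zeros p^`()].

Definition sendov_d (R : realType) (p : {poly R[i]}) : R :=
  sup [set crit_dist p z | z in zeros p].

(* An enumeration of the zeros of [p] with multiplicity:
   [p = lead_coef p *: \prod_(z <- root_seq p) ('X - z%:P)]. *)
Definition root_seq (R : realType) (p : {poly R[i]}) : seq R[i] :=
  sval (closed_field_poly_normal p).

(* For [p] and [q] monic of degree [n].  The value does not depend on the
   enumerations of the zeros, since all permutations are considered; the
   moduli are nonnegative, so that [0] is neutral for the maximum. *)
Definition root_dist (R : realType) (n : nat) (p q : {poly R[i]}) : R :=
  inf [set \big[Num.max/0]_(i < n)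
             Normc.normc ((root_seq p)`_i - (root_seq q)`_(s i))
      | s in [set: 'S_n]].

(* For [p] in [S_class n]. *)
Definition locally_maximal (R : realType) (n : nat) (p : {poly R[i]}) : Prop :=
  exists2 eps : R, 0 < eps &
    forall q, S_class n q -> root_dist n q p < eps -> sendov_d q <= sendov_d p.

Definition expi (R : realType) (t : R) : R[i] := Complex (cos t) (sin t).

Definition rho (R : realType) : R := 4^-1 `^ 3^-1.

Definition alpha1 (R : realType) : R :=
  3 * Num.sqrt 3 * rho R / (2 - 3 * rho R).

Definition alpha2 (R : realType) : R :=
  - (Num.sqrt 3 * ((3 * rho R + 2) ^+ 2 + 4)) / (2 * (3 * rho R - 2) ^+ 2).

Definition zeta (R : realType) (a : R) : R[i] :=
  expi (pi / 3 + alpha1 R * a + alpha2 R * a ^+ 2).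

Definition p_fam (R : realType) (a : R) : {poly R[i]} :=
  ('X - (a%:C%C)%:P) * ('X + 1) * ('X - (zeta a)%:P) * ('X - ((zeta a)^*%C)%:P).

Definition constC (R : realType) : R := 3 / (4 * rho R * (2 - 3 * rho R)).

(* Main.v *)
(* Put z = a + u. Since p_a is real, p_a'(a + u) is a real cubic with a root -s
   near -r and a conjugate pair of roots of squared modulus g, where s g is a
   quarter of its constant term. Hence |p_a|_a = min(s, sqrt g). The numbers
   alpha_1 and alpha_2 are chosen so that, with c = cos(arg zeta(a)) expanded to
   second order, the cubic takes at u = -(r + C a^2 + t a^3) the value
   -a^3 (12 r^2 t + O(1)): the intermediate value theorem then gives
   s = r + C a^2 + O(a^3), and the constant term being 4 (r + C a^2)^3 + O(a^3),
   sqrt g has the same expansion. The other zeros of p_a are at distance about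
   1 - r < r from a critical point, so they do not matter for d(p_a), and C > 0
   makes d(p_a) exceed d(z^4 + z) = r. *)
Require Import Defs.
From HB Require Import structures.
From mathcomp Require Import all_boot all_order all_algebra all_fingroup.
From mathcomp Require Import complex.
From mathcomp Require Import all_classical all_reals all_analysis.
From mathcomp Require Import ring lra.
Import Order.TTheory GRing.Theory Num.Theory.
Import numFieldNormedType.Exports.
Local Open Scope classical_set_scope.
Local Open Scope ring_scope.

Set Implicit Arguments.
Unset Strict Implicit.
Unset Printing Implicit Defensive.

(** * Distances between zeros and critical points *)

Lemma normc_ge0 (R : rcfType) (z : R[i]) : 0 <= Normc.normc z.
Proof. by case: z => x y; exact: sqrtr_ge0. Qed.

Lemma normc_le (R : rcfType) (x y M : R) :
  0 <= M -> x ^+ 2 + y ^+ 2 <= M ^+ 2 -> Normc.normc (Complex x y) <= M.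
Proof.
move=> M0 xyM.
by rewrite -[leRHS](ger0_norm M0) -[leRHS]sqrtr_sqr /= ler_wsqrtr.
Qed.

Lemma normc_le_ReIm (R : rcfType) (x y : R) :
  Normc.normc (Complex x y) <= `|x| + `|y|.
Proof.
apply: normc_le; first by rewrite addr_ge0.
rewrite sqrrD !real_normK ?num_real// lerD2r lerDl.
by rewrite mulrn_wge0 ?mulr_ge0.
Qed.

Lemma crit_dist_le (R : realType) (p : {poly R[i]}) (z w : R[i]) :
  zeros p^`() w -> crit_dist p z <= Normc.normc (z - w).
Proof.
move=> pw; apply: ge_inf; last by exists w.
by exists 0 => _ [v _ <-]; exact: normc_ge0.
Qed.

Lemma crit_dist_ge (R : realType) (p : {poly R[i]}) (z : R[i]) (x : R) :
  zeros p^`() !=set0 ->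
  (forall w, zeros p^`() w -> x <= Normc.normc (z - w)) -> x <= crit_dist p z.
Proof.
move=> [w pw] xle; apply: lb_le_inf; first by exists (Normc.normc (z - w)), w.
by move=> _ [v pv <-]; exact: xle.
Qed.

Lemma sendov_d_le (R : realType) (p : {poly R[i]}) (x : R) :
  zeros p !=set0 -> (forall z, zeros p z -> crit_dist p z <= x) ->
  sendov_d p <= x.
Proof.
move=> [w pw] lex; apply: ge_sup; first by exists (crit_dist p w), w.
by move=> _ [v pv <-]; exact: lex.
Qed.

Lemma sendov_d_max (R : realType) (p : {poly R[i]}) (z : R[i]) :
  zeros p z -> (forall v, zeros p v -> crit_dist p v <= crit_dist p z) ->
  sendov_d p = crit_dist p z.
Proof.
move=> pz lez; apply/eqP; rewrite eq_le; apply/andP; split.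
  by apply: sendov_d_le => //; exists z.
apply: ub_le_sup; last by exists z.
by exists (crit_dist p z) => _ [v pv <-]; exact: lez.
Qed.

(** The enumeration [root_seq p] comes from an existential, so its order is unknown; unique
    factorization into monic linear factors fixes it up to a permutation. *)
Lemma perm_root_seq (R : realType) (p : {poly R[i]}) (s : seq R[i]) :
  p = \prod_(z <- s) ('X - z%:P) -> perm_eq (root_seq p) s.
Proof.
move=> ps; apply: prod_XsubC_eq; rewrite -ps /root_seq.
have /monicP p1 : p \is monic by rewrite ps monic_prod_XsubC.
by case: closed_field_poly_normal => t /= pt; rewrite [RHS]pt p1 scale1r.
Qed.

Lemma root_dist_ge0 (R : realType) (n : nat) (p q : {poly R[i]}) :
  0 <= root_dist n p q.
Proof.
apply: lb_le_inf.
  by eexists; exists 1%g.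
move=> _ [s _ <-]; elim/big_ind: _ => // [x y x0 y0|i _]; last exact: normc_ge0.
by rewrite le_max x0.
Qed.

Lemma root_dist_le (R : realType) (n : nat) (s t : n.-tuple R[i]) (M : R) :
  0 <= M -> (forall i : 'I_n, Normc.normc (tnth s i - tnth t i) <= M) ->
  root_dist n (\prod_(z <- s) ('X - z%:P)) (\prod_(z <- t) ('X - z%:P)) <= M.
Proof.
move=> M0 stM; set p := \prod_(z <- s) _; set q := \prod_(z <- t) _.
have ps : perm_eq (root_seq p) s by exact: perm_root_seq.
have qt : perm_eq t (root_seq q) by rewrite perm_sym; exact: perm_root_seq.
have sizeq : size (root_seq q) == n by rewrite -(perm_size qt) size_tuple.
have /tuple_permP[u pu] := ps.
have /(@tuple_permP _ _ _ (Tuple sizeq))[v tv] := qt.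
(* With [u] matching [root_seq p] to [s] and [v] matching [t] to [root_seq q], the permutation
   [u * v] reproduces the pairing of [s] with [t] index by index. *)
apply: (@le_trans _ _ (\big[Num.max/0]_(i < n)
    Normc.normc ((root_seq p)`_i - (root_seq q)`_((u * v)%g i)))).
  apply: ge_inf; last by exists (u * v)%g.
  exists 0 => _ [w _ <-]; elim/big_ind: _ => // [x y x0 y0|i _].
    by rewrite le_max x0.
  exact: normc_ge0.
elim/big_ind: _ => // [x y xM yM|i _]; first by rewrite ge_max xM.
have -> : (root_seq p)`_i = tnth s (u i).
  by rewrite pu -tnth_nth tnth_mktuple.
have -> // : (root_seq q)`_((u * v)%g i) = tnth t (u i).
by rewrite permM (tnth_nth 0) tv -tnth_nth tnth_mktuple (tnth_nth 0).
Qed.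

(** * Constants and trigonometric estimates *)

Lemma rho_gt0 (R : realType) : 0 < rho R.
Proof. by rewrite powR_gt0// invr_gt0. Qed.

Lemma rho_cubed (R : realType) : rho R ^+ 3 = 1 / 4.
Proof.
rewrite -powR_mulrn ?(ltW (rho_gt0 R))// /rho -powRrM mulVf ?pnatr_eq0//.
by rewrite powRr1 ?invr_ge0// div1r.
Qed.

(** Ten digits are given because [2 - 3 * rho R] is only about 0.11: an error in [rho R] grows by a
    factor of about 280 in [constC R]. *)
Lemma rho_bounds (R : realType) :
  629 / 10 ^+ 3 + 960 / 10 ^+ 6 + 524 / 10 ^+ 9 + 9 / 10 ^+ 10 < rho R <
  629 / 10 ^+ 3 + 960 / 10 ^+ 6 + 525 / 10 ^+ 9.
Proof.
have := rho_cubed R; have := rho_gt0 R; set r := rho R => r0 r3.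
have cube_lt (x y : R) : 0 < y -> x ^+ 3 < y ^+ 3 -> x < y.
  move=> y0; apply: contraTT; rewrite -!leNgt => yx.
  by rewrite lerXn2r// nnegrE ltW// (lt_le_trans y0).
by apply/andP; split; apply: cube_lt; rewrite ?r3; clear -r0; lra.
Qed.

Lemma constC_bounds (R : realType) :
  `|constC R - (10 + 811 / 10 ^+ 3 + 549 / 10 ^+ 6 + 38 / 10 ^+ 8)|
    < 1 / 10 ^+ 7.
Proof.
rewrite /constC; have := rho_bounds R; set r := rho R.
set l := (X in X < r); set u := (X in r < X) => /andP[lr ru].
(* The chord over [[l, u]] bounds the square from above and the tangent at [l] from below, so that
   [r ^+ 2] can be treated as a separate variable under linear constraints. *)
have sq_le : r ^+ 2 <= (l + u) * r - l * u.
  rewrite -subr_ge0.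
  have -> : (l + u) * r - l * u - r ^+ 2 = (r - l) * (u - r) by ring.
  by apply: mulr_ge0; rewrite subr_ge0 ltW.
have sq_ge : 2 * l * r - l ^+ 2 <= r ^+ 2.
  rewrite -subr_ge0.
  have -> : r ^+ 2 - (2 * l * r - l ^+ 2) = (r - l) ^+ 2 by ring.
  exact: sqr_ge0.
have -> : 4 * r * (2 - 3 * r) = 8 * r - 12 * r ^+ 2 by ring.
move: (r ^+ 2) sq_le sq_ge lr ru => r2; rewrite /l /u => sq_le sq_ge lr ru.
have q0 : 0 < 8 * r - 12 * r2 by lra.
rewrite ltr_distl ltr_pdivlMr// ltr_pdivrMr//.
by clear q0; apply/andP; split; lra.
Qed.

Lemma cos_pi3 (R : realType) : cos (pi / 3) = 1 / 2 :> R.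
Proof.
have pi0 := pi_gt0 R; set x : R := pi / 3.
have cx0 : 0 < cos x by apply: cos_gt0_pihalf; rewrite /x; lra.
have : cos (x + x + x) = -1 by rewrite -cospi /x; congr cos; lra.
rewrite !cosD !sinD => h; have := sin2cos2 x => s2.
(* The triple-angle equation [4 c^3 - 3 c = -1] has this factored form, and [cos x > 0] rules out
   the root [-1]. *)
have : (cos x + 1) * (2 * cos x - 1) ^+ 2 = 0.
  have -> : (cos x + 1) * (2 * cos x - 1) ^+ 2 =
     (cos x * cos x - sin x * sin x) * cos x -
     (sin x * cos x + cos x * sin x) * sin x + 1 by ring: s2.
  by rewrite h; lra.
move/eqP; rewrite mulf_eq0 sqrf_eq0 => /orP[] /eqP; lra.
Qed.

Lemma sin_pi3 (R : realType) : sin (pi / 3) = Num.sqrt 3 / 2 :> R.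
Proof.
have pi0 := pi_gt0 R.
have sx0 : 0 < sin (pi / 3 : R) by apply: sin_gt0_pi; lra.
have : sin (pi / 3) ^+ 2 = (Num.sqrt 3 / 2) ^+ 2 :> R.
  by rewrite sin2cos2 cos_pi3 [RHS]expr_div_n sqr_sqrtr; lra.
by move/eqP; rewrite eqrXn2// ?ltW// ?divr_ge0 ?sqrtr_ge0// => /eqP.
Qed.

Lemma mean_value_bound (R : realType) (f df : R -> R) (x y M : R) :
  (forall t : R, is_derive t 1 f (df t)) ->
  (forall t, Num.min x y <= t <= Num.max x y -> `|df t| <= M) ->
  `|f y - f x| <= M * `|y - x|.
Proof.
move=> fdf; wlog xy : x y / x <= y => [th|] dfM.
  have [|/ltW yx] := leP x y; first by move=> /th; exact.
  rewrite distrC (distrC y); apply: th => // t ty; apply: dfM.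
  by rewrite minC maxC.
have fcont : {within `[x, y], continuous f}.
  apply: continuous_subspaceT => t.
  by apply: differentiable_continuous; apply/derivable1_diffP; have [] := fdf t.
have [t txy ->] := @MVT_segment _ f df _ _ xy (fun t _ => fdf t) fcont.
rewrite normrM ler_wpM2r//; apply: dfM.
by rewrite min_l// max_r//; rewrite in_itv in txy.
Qed.

Lemma cos_lipschitz (R : realType) (x y : R) : `|cos y - cos x| <= `|y - x|.
Proof.
rewrite -[leRHS]mul1r; apply: mean_value_bound => t _.
by rewrite normrN sin_max.
Qed.

Lemma sin_lipschitz (R : realType) (x y : R) : `|sin y - sin x| <= `|y - x|.
Proof.
rewrite -[leRHS]mul1r; apply: mean_value_bound => t _.
exact: cos_max.
Qed.

Lemma normr_between0 (R : realDomainType) (x t : R) :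
  Num.min 0 x <= t <= Num.max 0 x -> `|t| <= `|x|.
Proof.
by have [x0|/ltW x0] := leP 0 x => /andP[t0 t1];
  rewrite ?(ger0_norm x0) ?(ler0_norm x0) ler_norml; lra.
Qed.

(** Each use of the mean value bound raises the exponent by one: from [|sin t| <= |t|] to a
    quadratic bound on [cos t - 1], then to this cubic one. The constants are not sharp, since only
    the order in [x] matters. *)
Lemma sin_taylor (R : realType) (x : R) : `|sin x - x| <= `|x| ^+ 3.
Proof.
have cosB1 (t : R) : `|cos t - 1| <= `|t| ^+ 2.
  rewrite -cos0 expr2 -[X in _ <= _ * `|X|]subr0.
  apply: mean_value_bound => u /normr_between0.
  rewrite normrN => /(le_trans _); apply.
  by have := sin_lipschitz 0 u; rewrite sin0 !subr0.
have := @mean_value_bound _ (fun t : R => sin t - t) (fun t => cos t - 1) 0 x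
  (`|x| ^+ 2).
rewrite sin0 !subr0 -exprSr; apply => t /normr_between0 tx.
by rewrite (le_trans (cosB1 _))// lerXn2r// nnegrE.
Qed.

Lemma cos_taylor (R : realType) (x : R) :
  `|cos x - 1 + x ^+ 2 / 2| <= `|x| ^+ 4.
Proof.
have := @mean_value_bound _ (fun t : R => cos t - 1 + t ^+ 2 / 2)
  (fun t => - (sin t - t)) 0 x (`|x| ^+ 3).
rewrite cos0 subrr expr0n mul0r addr0 !subr0 -exprSr; apply.
  move=> t; apply: is_derive_eq.
  by rewrite /GRing.scale /=; lra.
move=> t /normr_between0 tx.
by rewrite normrN (le_trans (sin_taylor _))// lerXn2r// nnegrE.
Qed.

(** * Functions bounded near 0 *)

(** This is [f = O(1)] at [0+]. Error terms are written as [e a * a ^+ 3] with [e] bounded, so that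
    expansions become exact algebraic identities and boundedness is checked term by term. *)
Definition near0_bounded (R : realType) (f : R -> R) : Prop :=
  exists M, \forall a \near 0^'+, `|f a| <= M.

Lemma near0_bounded_cst (R : realType) (k : R) : near0_bounded (fun=> k).
Proof. by exists `|k|; near=> a. Unshelve. all: by end_near. Qed.

Lemma near0_bounded_id (R : realType) : near0_bounded (fun a : R => a).
Proof.
exists 1; near=> a; rewrite gtr0_norm; first by near: a; exact: nbhs_right_le.
by near: a; exact: nbhs_right_gt.
Unshelve. all: by end_near. Qed.

Lemma near0_boundedD (R : realType) (f g : R -> R) :
  near0_bounded f -> near0_bounded g -> near0_bounded (fun a => f a + g a).
Proof.
move=> [M fM] [N gN]; exists (M + N); near=> a.
rewrite (le_trans (ler_normD _ _))// lerD//; near: a; [exact: fM|exact: gN].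
Unshelve. all: by end_near. Qed.

Lemma near0_boundedM (R : realType) (f g : R -> R) :
  near0_bounded f -> near0_bounded g -> near0_bounded (fun a => f a * g a).
Proof.
move=> [M fM] [N gN]; exists (M * N); near=> a.
rewrite normrM ler_pM//; near: a; [exact: fM|exact: gN].
Unshelve. all: by end_near. Qed.

Lemma near0_boundedN (R : realType) (f : R -> R) :
  near0_bounded f -> near0_bounded (fun a => - f a).
Proof. by move=> [M fM]; exists M; apply: filterS fM => a; rewrite normrN. Qed.

Lemma near0_boundedX (R : realType) (f : R -> R) (n : nat) :
  near0_bounded f -> near0_bounded (fun a => f a ^+ n).
Proof.
move=> [M fM]; exists (M ^+ n); apply: filterS fM => a faM.
by rewrite normrX lerXn2r// nnegrE// (le_trans _ faM).
Qed.

Lemma near0_bounded_le (R : realType) (f g : R -> R) :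
  (\forall a \near 0^'+, `|f a| <= `|g a|) ->
  near0_bounded g -> near0_bounded f.
Proof.
move=> fg [M gM]; exists M; near=> a.
by apply: (@le_trans _ _ `|g a|); near: a; [exact: fg|exact: gM].
Unshelve. all: by end_near. Qed.

Ltac near0_bounded_tac := rewrite /=;
  repeat first [ assumption
    | exact: near0_bounded_cst
    | exact: near0_bounded_id
    | apply: near0_boundedD
    | apply: near0_boundedN
    | apply: near0_boundedM
    | apply: near0_boundedX ].

Lemma near0_bounded_small (R : realType) (f : R -> R) (eps : R) :
  near0_bounded f -> 0 < eps -> \forall a \near 0^'+, `|a * f a| <= eps.
Proof.
move=> [M fM] eps0; have M0 : 0 < `|M| + 1 by rewrite ltr_wpDl.
near=> a.
have a0 : 0 < a by near: a; exact: nbhs_right_gt.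
have fa : `|f a| <= M by near: a; exact: fM.
have : a <= eps / (`|M| + 1) by near: a; apply: nbhs_right_le; rewrite divr_gt0.
rewrite ler_pdivlMr// normrM (gtr0_norm a0); apply: le_trans.
by rewrite ler_pM2l// (le_trans fa)// (le_trans (ler_norm _))// lerDl.
Unshelve. all: by end_near. Qed.

(** The Taylor coefficients of [cos (pi / 3 + alpha1 R * a + alpha2 R * a ^+ 2)] in [a], namely
    [- (sqrt 3 / 2) alpha1] and [- (sqrt 3 / 2) alpha2 - alpha1^2 / 4], in a form free of the square
    root. *)
Definition cos_coef1 (R : realType) : R :=
  - (9 * rho R) / (2 * (2 - 3 * rho R)).

Definition cos_coef2 (R : realType) : R :=
  (9 * rho R + 6) / (2 - 3 * rho R) ^+ 2.

Lemma rho_itv (R : realType) : 629 / 10 ^+ 3 < rho R < 63 / 100.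
Proof.
have := rho_bounds R; move: (rho R) => r /andP[lr ru].
by apply/andP; split; lra.
Qed.

Lemma two_sub_rho_neq0 (R : realType) : 2 - 3 * rho R != 0.
Proof.
by have := rho_itv R; move: (rho R) => r /andP[_ ru]; rewrite gt_eqF//; lra.
Qed.

Lemma cos_zeta_expansion (R : realType) :
  exists2 e : R -> R, near0_bounded e & \forall a \near 0^'+,
    cos (pi / 3 + alpha1 R * a + alpha2 R * a ^+ 2) =
    1 / 2 + cos_coef1 R * a + cos_coef2 R * a ^+ 2 + e a * a ^+ 3.
Proof.
(* The angle exceeds [pi / 3] by [a * d a]; [u] and [v] are the Taylor remainders of cosine and sine
   at this increment, divided by [a ^+ 3]. *)
pose d (a : R) := alpha1 R + alpha2 R * a.
have d_bounded : near0_bounded d by near0_bounded_tac.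
pose u (a : R) := (cos (a * d a) - 1 + (a * d a) ^+ 2 / 2) / a ^+ 3.
pose v (a : R) := (sin (a * d a) - a * d a) / a ^+ 3.
have u_bounded : near0_bounded u.
  apply: (@near0_bounded_le _ _ (fun a => a * d a ^+ 4)); last first.
    by near0_bounded_tac.
  near=> a; have a0 : 0 < a by near: a; exact: nbhs_right_gt.
  rewrite /u normf_div normrX (gtr0_norm a0) ler_pdivrMr ?exprn_gt0//.
  rewrite (le_trans (cos_taylor _))// 2!normrM (gtr0_norm a0) normrX.
  by rewrite le_eqVlt; apply/orP; left; apply/eqP; ring.
have v_bounded : near0_bounded v.
  apply: (@near0_bounded_le _ _ (fun a => d a ^+ 3)); last by near0_bounded_tac.
  near=> a; have a0 : 0 < a by near: a; exact: nbhs_right_gt.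
  rewrite /v normf_div normrX (gtr0_norm a0) ler_pdivrMr ?exprn_gt0//.
  rewrite (le_trans (sin_taylor _))// normrM (gtr0_norm a0) normrX.
  by rewrite le_eqVlt; apply/orP; left; apply/eqP; ring.
(* Besides the two remainders, the square [- (a * d a) ^+ 2 / 4] contributes its terms in [a ^+ 3]
   and [a ^+ 4]. *)
exists (fun a => u a / 2 - Num.sqrt 3 / 2 * v a - alpha1 R * alpha2 R / 2
  - alpha2 R ^+ 2 * a / 4); first by near0_bounded_tac.
near=> a; have a0 : 0 < a by near: a; exact: nbhs_right_gt.
have an0 : a != 0 by rewrite gt_eqF.
have -> : pi / 3 + alpha1 R * a + alpha2 R * a ^+ 2 = pi / 3 + a * d a.
  by rewrite /d; ring.
rewrite cosD cos_pi3 sin_pi3.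
have -> : cos (a * d a) = 1 - (a * d a) ^+ 2 / 2 + u a * a ^+ 3.
  by rewrite /u; field.
have -> : sin (a * d a) = a * d a + v a * a ^+ 3 by rewrite /v; field.
have r0 := two_sub_rho_neq0 R.
have s3 : Num.sqrt 3 ^+ 2 = 3 :> R by rewrite sqr_sqrtr.
(* The root of 3 enters both coefficients only through its square. *)
have alpha1E : Num.sqrt 3 / 2 * alpha1 R = - cos_coef1 R.
  have -> : Num.sqrt 3 / 2 * alpha1 R
      = Num.sqrt 3 ^+ 2 * 3 * rho R / (2 * (2 - 3 * rho R)).
    by rewrite /alpha1; field.
  by rewrite s3 /cos_coef1; field.
have alpha2E : Num.sqrt 3 / 2 * alpha2 R + alpha1 R ^+ 2 / 4 = - cos_coef2 R.
  have -> : Num.sqrt 3 / 2 * alpha2 R + alpha1 R ^+ 2 / 4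
      = Num.sqrt 3 ^+ 2 * (9 * rho R ^+ 2 - (3 * rho R + 2) ^+ 2 - 4)
        / (4 * (2 - 3 * rho R) ^+ 2).
    rewrite /alpha1 /alpha2; field.
    by rewrite r0 -opprB oppr_eq0 r0.
  by rewrite s3 /cos_coef2; field.
rewrite -[cos_coef1 R]opprK -[cos_coef2 R]opprK -alpha1E -alpha2E /d; field.
Unshelve. all: by end_near. Qed.

(** * Expansion of the roots of the critical cubic *)

(** The three identities from here to [constCE] express the choice of [alpha1], [alpha2] and
    [constC]. This one cancels the term in [a] of the cubic at [r + C a^2], and the other two
    together cancel the term in [a^2]. In addition, [constCE] matches the term in [a^2] of
    [(r + C a^2)^3] with that of a quarter of the constant term. *)
Lemma cos_coef1E (R : realType) :
  cos_coef1 R * (6 * rho R - 4) = 9 * rho R.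
Proof. by rewrite /cos_coef1; field; exact: two_sub_rho_neq0. Qed.

Lemma cos_coef2E (R : realType) :
  cos_coef2 R * (3 * rho R - 2) = 4 * cos_coef1 R - 3.
Proof. by rewrite /cos_coef1 /cos_coef2; field; exact: two_sub_rho_neq0. Qed.

Lemma constCE (R : realType) : 6 * rho R ^+ 2 * constC R = - cos_coef1 R.
Proof.
rewrite /cos_coef1 /constC; field.
by rewrite two_sub_rho_neq0 gt_eqF// rho_gt0.
Qed.

(* With [c] the real part of [zeta a] and [z = a + u], the value of [p_fam a] at
   [z] is [u (u ^ 3 + shifted2 u ^ 2 + shifted1 u + shifted0)]; the derivative
   there is [4 (u + s) (u ^ 2 + quad1 u + quad0)] if [crit_cubic a c s = 0]. *)
Definition shifted2 (R : realType) (a c : R) : R := 1 + 3 * a - 2 * c.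

Definition shifted1 (R : realType) (a c : R) : R :=
  (1 + a) * (2 * a - 2 * c) + (a ^+ 2 - 2 * c * a + 1).

Definition shifted0 (R : realType) (a c : R) : R :=
  (1 + a) * (a ^+ 2 - 2 * c * a + 1).

Definition crit_cubic (R : realType) (a c s : R) : R :=
  4 * s ^+ 3 - 3 * shifted2 a c * s ^+ 2 + 2 * shifted1 a c * s - shifted0 a c.

Definition quad1 (R : realType) (a c s : R) : R :=
  (3 * shifted2 a c - 4 * s) / 4.

Definition quad0 (R : realType) (a c s : R) : R :=
  (2 * shifted1 a c - 3 * shifted2 a c * s + 4 * s ^+ 2) / 4.

Lemma crit_cubicE (R : realType) (a c s : R) :
  4 * s * quad0 a c s = crit_cubic a c s + shifted0 a c.
Proof. by rewrite /quad0 /crit_cubic; field. Qed.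

Lemma crit_cubic_root (R : realType) (a c m d : R) :
  0 <= d -> crit_cubic a c (m - d) <= 0 <= crit_cubic a c (m + d) ->
  exists2 s, `|s - m| <= d & crit_cubic a c s = 0.
Proof.
move=> d0; pose P : {poly R} := 4%:P * 'X ^+ 3 - (3 * shifted2 a c)%:P * 'X ^+ 2
  + (2 * shifted1 a c)%:P * 'X - (shifted0 a c)%:P.
have PE s : P.[s] = crit_cubic a c s.
  by rewrite /P !(hornerD, hornerN, hornerM, hornerC, hornerXn, hornerX).
have mdmd : m - d <= m + d by lra.
rewrite -!PE => /(poly_ivt mdmd)[s smd /eqP]; rewrite PE => Ps.
by exists s => //; rewrite ler_distl.
Qed.

Section expansion.
Variables (R : realType) (e : R -> R).
Let r := rho R.
Let C := constC R.
Let c1 := cos_coef1 R.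
Let c2 := cos_coef2 R.
Let c a := 1 / 2 + c1 * a + c2 * a ^+ 2 + e a * a ^+ 3.

(** [A1], [B1] and [D2] are what is left of the shifted coefficients once their explicit powers of
    [a] are taken out. The constant term has no part linear in [a] because [c] starts at [1 / 2]. *)
Let A1 a := 3 - 2 * c1 + a * (- 2 * c2 - 2 * e a * a).
Let B2 a := - 2 * e a - 4 * c2 - 4 * e a * a.
Let B1 a := - 2 * c1 + a * (3 - 2 * c2 - 4 * c1 + a * B2 a).
Let D2 a := 1 - 2 * c1 - (1 + a) * (2 * c2 + 2 * e a * a).

(** After division by [a ^+ 3], the cubic at [r + C a^2 + t a^3] is [12 r^2 t] plus an error: [P] is
    the part of the error free of [t], and [a * H t a * t] the rest. *)
Let P a := 6 * e a * r ^+ 2 - 6 * A1 a * r * C - 3 * A1 a * a ^+ 2 * C ^+ 2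
  + 2 * r * B2 a + 2 * B1 a * C - D2 a
  + a * (12 * r * C ^+ 2 + 4 * a ^+ 2 * C ^+ 3).
Let H t a := - 6 * A1 a * r - 3 * A1 a * a ^+ 2 * (2 * C + a * t) + 2 * B1 a
  + a * (12 * r * (2 * C + a * t)
         + 4 * a ^+ 2 * (3 * C ^+ 2 + 3 * C * a * t + a ^+ 2 * t ^+ 2)).

Lemma shifted2_expansion a : shifted2 a (c a) = a * A1 a.
Proof. by rewrite /shifted2 /c /A1; field. Qed.

Lemma shifted1_expansion a : shifted1 a (c a) = a * B1 a.
Proof. by rewrite /shifted1 /c /B1 /B2; field. Qed.

Lemma shifted0_expansion a :
  shifted0 a (c a) = 1 + a ^+ 2 * (- 2 * c1 + a * D2 a).
Proof. by rewrite /shifted0 /c /D2; field. Qed.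

Lemma crit_cubic_expansion t a :
  crit_cubic a (c a) (r + C * a ^+ 2 + t * a ^+ 3) =
  a ^+ 3 * (12 * r ^+ 2 * t + P a + a * H t a * t).
Proof.
rewrite /crit_cubic shifted2_expansion shifted1_expansion shifted0_expansion.
apply/eqP; rewrite -subr_eq0; apply/eqP.
(* The coefficients of [1], [a] and [a ^+ 2] vanish separately, by [rho_cubed] and the three
   identities behind the choice of constants. *)
transitivity ((4 * r ^+ 3 - 1) + a * r * (c1 * (6 * r - 4) - 9 * r)
  + a ^+ 2 * (2 * (6 * r ^+ 2 * C + c1)
    + 2 * r * (c2 * (3 * r - 2) - (4 * c1 - 3)))).
  by rewrite /P /H /A1 /B1 /B2 /D2; ring.
by rewrite /r /C /c1 /c2 cos_coef1E cos_coef2E constCE rho_cubed; field.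
Qed.

Hypothesis e_bounded : near0_bounded e.

Lemma D2_bounded : near0_bounded D2.
Proof. by rewrite /D2; near0_bounded_tac. Qed.

Lemma P_bounded : near0_bounded P.
Proof. by rewrite /P /A1 /B1 /B2 /D2; near0_bounded_tac. Qed.

Lemma H_bounded t : near0_bounded (H t).
Proof. by rewrite /H /A1 /B1 /B2; near0_bounded_tac. Qed.

Lemma crit_root_near : exists K, \forall a \near 0^'+,
  exists2 s, `|s - (r + C * a ^+ 2)| <= K * a ^+ 3 & crit_cubic a (c a) s = 0.
Proof.
(* With [q = r ^+ 2 >= 1 / 4] the leading term [12 q t] is at least [3 t], which beats an error of
   at most [(t - 1) + t]. Hence the cubic changes sign between [t = - T] and [t = T]. *)
have signs (p h k t q : R) : `|p| <= t - 1 -> `|h| <= 1 -> `|k| <= 1 ->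
    0 < t -> 1 / 4 <= q ->
    12 * q * (- t) + p + k * (- t) <= 0 <= 12 * q * t + p + h * t.
  rewrite !ler_norml.
  move=> /andP[p1 p2] /andP[h1 h2] /andP[k1 k2] t0 q4.
  have qt : t <= 4 * q * t by rewrite ler_peMl ?(ltW t0)//; lra.
  have ht : - t <= h * t by rewrite -mulN1r ler_wpM2r// ltW.
  have kt : - t <= k * t by rewrite -mulN1r ler_wpM2r// ltW.
  by apply/andP; split; lra.
have [M PM] := P_bounded; pose T := `|M| + 1; exists T; near=> a.
have a0 : 0 < a by near: a; exact: nbhs_right_gt.
have a30 : 0 < a ^+ 3 by rewrite exprn_gt0.
have Pa : `|P a| <= T - 1.
  rewrite /T addrK; apply: (@le_trans _ _ M); last exact: ler_norm.
  by near: a; exact: PM.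
have T0 : 0 < T by rewrite ltr_wpDl.
have H1 : `|a * H T a| <= 1.
  by near: a; exact: near0_bounded_small (H_bounded _) _.
have H2 : `|a * H (- T) a| <= 1.
  by near: a; exact: near0_bounded_small (H_bounded _) _.
have r2 : 1 / 4 <= r ^+ 2.
  have /andP[rl _] := rho_itv R.
  have -> : 1 / 4 = (1 / 2) ^+ 2 :> R by field.
  by rewrite lerXn2r ?nnegrE ?(ltW (rho_gt0 R))//; move: rl; rewrite -/r; lra.
apply: crit_cubic_root; first by rewrite ltW// mulr_gt0.
rewrite -mulNr !crit_cubic_expansion.
rewrite (pmulr_rle0 _ a30) (pmulr_rge0 _ a30).
exact: signs.
Unshelve. all: by end_near. Qed.

(** At a root [s] of the cubic, [s * quad0] equals [shifted0 / 4]. This bound therefore carries the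
    expansion of [s] over to [quad0], the squared modulus of the conjugate pair. *)
Lemma shifted0_cube_near : exists M, \forall a \near 0^'+,
  `|shifted0 a (c a) / 4 - (r + C * a ^+ 2) ^+ 3| <= M * a ^+ 3.
Proof.
pose E a := D2 a / 4 - 3 * r * C ^+ 2 * a - C ^+ 3 * a ^+ 3.
have [M EM] : near0_bounded E.
  by have D2b := D2_bounded; rewrite /E; near0_bounded_tac.
exists M; near=> a; have a0 : 0 < a by near: a; exact: nbhs_right_gt.
have -> : shifted0 a (c a) / 4 - (r + C * a ^+ 2) ^+ 3 = E a * a ^+ 3.
  rewrite shifted0_expansion; apply/eqP; rewrite -subr_eq0; apply/eqP.
  transitivity (1 / 4 - r ^+ 3 - a ^+ 2 * (6 * r ^+ 2 * C + c1) / 2).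
    by rewrite /E; field.
  by rewrite /r /C /c1 constCE rho_cubed; field.
rewrite normrM [X in _ * X]gtr0_norm ?exprn_gt0// ler_pM2r ?exprn_gt0//.
by near: a; exact: EM.
Unshelve. all: by end_near. Qed.
End expansion.

(** * Stability of square roots and explicit tolerances *)

Lemma sqr_stable (R : rcfType) (s m q d h : R) :
  1 / 2 <= s -> 1 / 2 <= m <= 1 -> `|s - m| <= d -> `|s * q - m ^+ 3| <= h ->
  `|q - m ^+ 2| <= 2 * (d + h).
Proof.
move=> s2 /andP[m2 m1] smd sqm; have s0 : 0 < s by lra.
rewrite -(ler_pM2l s0) -{1}(gtr0_norm s0) -normrM.
have -> : s * (q - m ^+ 2) = (s * q - m ^+ 3) - m ^+ 2 * (s - m) by ring.
have dh : 0 <= d + h by rewrite addr_ge0// (le_trans _ smd, le_trans _ sqm).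
rewrite (le_trans (ler_normB _ _))// (@le_trans _ _ (h + d))//.
  rewrite lerD// normrM -[leRHS]mul1r ler_pM// ger0_norm ?sqr_ge0//.
  by rewrite expr_le1//; lra.
by rewrite mulrA addrC ler_peMl//; lra.
Qed.

Lemma sqrt_stable (R : rcfType) (m q d : R) :
  1 / 2 <= m -> 0 <= q -> `|q - m ^+ 2| <= d -> `|Num.sqrt q - m| <= 2 * d.
Proof.
move=> m2 q0; rewrite -{1}(sqr_sqrtr q0) subr_sqr normrM => h.
have s0 := sqrtr_ge0 q; move: (Num.sqrt q) s0 h => g g0 h.
have gm : 1 / 2 <= `|g + m| by rewrite ger0_norm; lra.
have : `|g - m| * (1 / 2) <= `|g - m| * `|g + m| by rewrite ler_wpM2l.
by lra.
Qed.

(* The tolerance 1/100 is small enough to make the roots of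
   [u ^ 2 + quad1 u + quad0] nonreal, hence of modulus [Num.sqrt quad0], and to
   keep the zeros of [p_fam a] other than [a] within 6/10 of a critical point. *)
Record crit_data (R : realType) (a c s : R) : Prop := CritData {
  crit_data_root : crit_cubic a c s = 0 ;
  crit_data_a : 0 < a <= 1 / 100 ;
  crit_data_c : `|c - 1 / 2| <= 1 / 100 ;
  crit_data_shifted2 : `|shifted2 a c| <= 1 / 100 ;
  crit_data_s : `|s - rho R| <= 1 / 100 ;
  crit_data_quad0 : `|quad0 a c s - rho R ^+ 2| <= 1 / 100 }.

(** The tolerances 1/1000 leave room for the 1/100 of [crit_data]; for instance [shifted2 a c] is
    [3 a - 2 (c - 1/2)]. In [4 * (d + h)], one factor 2 comes from dividing by [s >= 1/2] in
    [sqr_stable], the other from [sqrt_stable]. *)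
Lemma crit_data_of_estimates (R : realType) (a c s m d h : R) :
  crit_cubic a c s = 0 -> 0 < a <= 1 / 1000 -> `|c - 1 / 2| <= 1 / 1000 ->
  `|m - rho R| <= 1 / 1000 -> `|s - m| <= d -> d <= 1 / 1000 ->
  `|shifted0 a c / 4 - m ^+ 3| <= h -> 2 * (d + h) <= 1 / 1000 ->
  crit_data a c s /\ `|Num.sqrt (quad0 a c s) - m| <= 4 * (d + h).
Proof.
move=> cs0 a_bd cc mr smd d_le mh dh_le.
have r_bd := rho_itv R.
have sm : `|s - m| <= 1 / 1000 by exact: le_trans d_le.
have m_bd : 1 / 2 <= m <= 1 by clear -mr r_bd; move: mr; rewrite ler_norml; lra.
have s_bd : 1 / 2 <= s.
  by clear -mr sm r_bd; move: mr sm; rewrite !ler_norml; lra.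
have qm : `|quad0 a c s - m ^+ 2| <= 2 * (d + h).
  apply: (@sqr_stable _ s) => //.
  have -> // : s * quad0 a c s = shifted0 a c / 4.
  by have := crit_cubicE a c s; rewrite cs0; clear; lra.
have qr : `|quad0 a c s - rho R ^+ 2| <= 1 / 100.
  have -> : quad0 a c s - rho R ^+ 2 =
    quad0 a c s - m ^+ 2 + (m - rho R) * (m + rho R) by ring.
  rewrite (le_trans (ler_normD _ _))//.
  have : `|(m - rho R) * (m + rho R)| <= 1 / 1000 * 2.
    rewrite normrM ler_pM//.
    by clear -m_bd r_bd; rewrite ler_norml; lra.
  by clear -qm dh_le; lra.
have q_ge0 : 0 <= quad0 a c s.
  have : (1 / 2) ^+ 2 <= rho R ^+ 2.
    by apply: lerXn2r; rewrite ?nnegrE; clear -r_bd; lra.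
  by clear -qr; move: qr; rewrite ler_norml; lra.
split.
  split => //.
  - by clear -a_bd; lra.
  - by clear -cc; lra.
  - by clear -cc a_bd; move: cc; rewrite /shifted2 !ler_norml; lra.
  - by clear -sm mr; move: sm mr; rewrite !ler_norml; lra.
have /andP[m2 _] := m_bd.
by rewrite (le_trans (sqrt_stable m2 q_ge0 qm))// mulrA -natrM.
Qed.

Lemma crit_data_near (R : realType) : exists2 K, 0 <= K &
  \forall a \near (0 : R)^'+,
    let c := cos (pi / 3 + alpha1 R * a + alpha2 R * a ^+ 2) in
    let m := rho R + constC R * a ^+ 2 in
    exists s, [/\ crit_data a c s, `|s - m| <= K * a ^+ 3 &
      `|Num.sqrt (quad0 a c s) - m| <= K * a ^+ 3].
Proof.
have [e e_bounded cosE] := cos_zeta_expansion R.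
have [K rootK] := crit_root_near e_bounded.
have [M cubeM] := shifted0_cube_near e_bounded.
have Kb : near0_bounded (fun a : R => K * a ^+ 2) by near0_bounded_tac.
have KMb : near0_bounded (fun a : R => 2 * (K + M) * a ^+ 2).
  by near0_bounded_tac.
have Cb : near0_bounded (fun a : R => constC R * a) by near0_bounded_tac.
have cb : near0_bounded
    (fun a : R => cos_coef1 R + cos_coef2 R * a + e a * a ^+ 2).
  by near0_bounded_tac.
have k0 : 0 < 1 / 1000 :> R by lra.
(* This is the bound [4 * (d + h)] with [d = K a^3] and [h = M a^3]; the absolute values make it
   nonnegative and large enough for [s] as well. *)
exists (4 * (`|K| + `|M|)); first by rewrite mulr_ge0// addr_ge0.
near=> a; set c := cos _; set m := rho R + _.
have a0 : 0 < a by near: a; exact: nbhs_right_gt.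
have a30 : 0 < a ^+ 3 by rewrite exprn_gt0.
have a1 : a <= 1 / 1000 by near: a; exact: nbhs_right_le k0.
have cE : c = 1 / 2 + cos_coef1 R * a + cos_coef2 R * a ^+ 2 + e a * a ^+ 3.
  by rewrite /c; near: a; exact: cosE.
have [s sK cs0] : exists2 s, `|s - m| <= K * a ^+ 3 & crit_cubic a c s = 0.
  by rewrite cE /m; near: a; exact: rootK.
have mM : `|shifted0 a c / 4 - m ^+ 3| <= M * a ^+ 3.
  by rewrite cE /m; near: a; exact: cubeM.
have K1 : K * a ^+ 3 <= 1 / 1000.
  rewrite (le_trans (ler_norm _))//.
  have -> : K * a ^+ 3 = a * (K * a ^+ 2) by ring.
  by near: a; exact: near0_bounded_small Kb k0.
have KM1 : 2 * (K * a ^+ 3 + M * a ^+ 3) <= 1 / 1000.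
  rewrite (le_trans (ler_norm _))//.
  have -> : 2 * (K * a ^+ 3 + M * a ^+ 3) = a * (2 * (K + M) * a ^+ 2) by ring.
  by near: a; exact: near0_bounded_small KMb k0.
have mr : `|m - rho R| <= 1 / 1000.
  have -> : m - rho R = a * (constC R * a) by rewrite /m; ring.
  by near: a; exact: near0_bounded_small Cb k0.
have cc : `|c - 1 / 2| <= 1 / 1000.
  have -> : c - 1 / 2 = a * (cos_coef1 R + cos_coef2 R * a + e a * a ^+ 2).
    by rewrite cE; ring.
  by near: a; exact: near0_bounded_small cb k0.
have a_bd : 0 < a <= 1 / 1000 by rewrite a0.
have [cd sqrtM] := crit_data_of_estimates cs0 a_bd cc mr sK K1 mM KM1.
have KM : 4 * (K * a ^+ 3 + M * a ^+ 3) <= 4 * (`|K| + `|M|) * a ^+ 3.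
  rewrite -mulrDl mulrA ler_pM2r// ler_pM2l//.
  by rewrite lerD ?ler_norm.
exists s; split => //; last exact: le_trans KM.
rewrite (le_trans sK)// ler_pM2r// (le_trans (ler_norm _))//.
by rewrite (@le_trans _ _ (`|K| + `|M|)) ?lerDl// ler_peMl ?addr_ge0// ler1n.
Unshelve. all: by end_near. Qed.

(** * Zeros and critical points of the family *)

Definition zeta_re (R : realType) (a : R) : R :=
  cos (pi / 3 + alpha1 R * a + alpha2 R * a ^+ 2).

Definition zeta_im (R : realType) (a : R) : R :=
  sin (pi / 3 + alpha1 R * a + alpha2 R * a ^+ 2).

Lemma zetaE (R : realType) (a : R) : zeta a = Complex (zeta_re a) (zeta_im a).
Proof. by []. Qed.

Lemma zeta_im_sq (R : realType) (a : R) : zeta_im a ^+ 2 = 1 - zeta_re a ^+ 2.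
Proof. exact: sin2cos2. Qed.

Lemma zetaD_conj (R : realType) (a : R) :
  zeta a + ((zeta a)^*)%C = (2 * zeta_re a)%:C%C.
Proof. by rewrite addcJ rmorphM /= rmorph_nat. Qed.

Lemma zetaM_conj (R : realType) (a : R) : zeta a * ((zeta a)^*)%C = 1.
Proof.
rewrite zetaE -sqr_normc normc_def /= zeta_im_sq addrCA subrr addr0 sqrtr1.
by rewrite expr1n.
Qed.

Lemma p_fam_prod (R : realType) (a : R) :
  p_fam a = \prod_(z <- [:: a%:C%C; -1; zeta a; ((zeta a)^*)%C]) ('X - z%:P).
Proof.
by rewrite !big_cons big_nil mulr1 polyCN opprK /p_fam !mulrA.
Qed.

Lemma p_famE (R : realType) (a : R) : p_fam a =
  ('X - (a%:C%C)%:P) * ('X + 1) * ('X ^+ 2 - (2 * zeta_re a)%:C%C%:P * 'X + 1).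
Proof.
rewrite /p_fam -zetaD_conj -[X in _ * (_ + X)](@polyC1 R[i]) -(zetaM_conj a).
by rewrite polyCD polyCM; ring.
Qed.

Lemma zeta_re0 (R : realType) : zeta_re 0 = 1 / 2 :> R.
Proof. by rewrite /zeta_re expr0n /= !mulr0 !addr0 cos_pi3. Qed.

Lemma p_fam0 (R : realType) : p_fam (0 : R) = 'X ^+ 4 + 'X.
Proof.
have -> : p_fam (0 : R) = ('X - 0) * ('X + 1) * ('X ^+ 2 - 1 * 'X + 1).
  by rewrite p_famE zeta_re0 (_ : 2 * (1 / 2) = 1) ?polyC0 ?polyC1//; field.
by ring.
Qed.

Lemma S_class_p_fam (R : realType) (a : R) :
  0 <= a <= 1 -> S_class 4 (p_fam a).
Proof.
move=> /andP[a0 a1]; rewrite p_fam_prod; split.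
- exact: monic_prod_XsubC.
- exact: size_prod_XsubC.
have norm_zeta : `|zeta a| <= 1.
  by rewrite normc_def /= zeta_im_sq addrCA subrr addr0 sqrtr1.
move=> z; rewrite /zeros /= root_prod_XsubC !inE => /or4P[] /eqP ->.
- by rewrite normc_def /= expr0n addr0 sqrtr_sqr ger0_norm// lecR.
- by rewrite normrN1.
- exact: norm_zeta.
- by move: norm_zeta; rewrite -normcJ.
Qed.

Lemma deriv_p_fam (R : realType) (a : R) (u : R[i]) :
  (p_fam a)^`().[a%:C%C + u] = 4 * u ^+ 3
    + 3 * (shifted2 a (zeta_re a))%:C%C * u ^+ 2
    + 2 * (shifted1 a (zeta_re a))%:C%C * u + (shifted0 a (zeta_re a))%:C%C.
Proof.
rewrite p_famE -[1]polyC1 !(derivM, derivD, derivN, derivC, derivXn, derivX).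
rewrite !(hornerD, hornerN, hornerM, hornerMn, hornerC, hornerXn, hornerX).
rewrite /shifted2 /shifted1 /shifted0.
move: (zeta_re a) => c.
ring.
Qed.

Lemma crit_factor (R : realType) (a s : R) (u : R[i]) :
  crit_cubic a (zeta_re a) s = 0 ->
  root (p_fam a)^`() (a%:C%C + u) =
  (u + s%:C%C == 0) || (u ^+ 2 + (quad1 a (zeta_re a) s)%:C%C * u
                          + (quad0 a (zeta_re a) s)%:C%C == 0).
Proof.
move: (zeta_re a) (deriv_p_fam a u) => c pu; rewrite rootE pu => cs0.
rewrite -mulf_eq0 -[RHS](mulrI_eq0 _ (lregP (_ : 4 != 0))) ?pnatr_eq0//.
congr (_ == 0).
have -> : shifted0 a c = 4 * s * quad0 a c s by rewrite crit_cubicE cs0 add0r.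
have -> : shifted2 a c = 4 * (quad1 a c s + s) / 3 by rewrite /quad1; field.
have -> : shifted1 a c = 2 * (quad0 a c s + s * quad1 a c s).
  by rewrite /quad0 /quad1; field.
by field.
Qed.

Lemma normc_sub_shift (R : rcfType) (z u : R[i]) :
  Normc.normc (z - (z + u)) = Normc.normc u.
Proof. by rewrite opprD addNKr normcN. Qed.

Lemma sqr_itv (R : realDomainType) (l x u : R) :
  0 <= l -> l <= x <= u -> l ^+ 2 <= x ^+ 2 <= u ^+ 2.
Proof.
move=> l0 /andP[lx xu]; have x0 := le_trans l0 lx.
by rewrite !lerXn2r ?nnegrE// (le_trans x0).
Qed.

(** * Distances from the zeros to the critical points *)

Section crit_points.
Variables (R : realType) (a s : R).
Let c := zeta_re a.
Let b := quad1 a c s.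
Let q := quad0 a c s.
Hypothesis cd : crit_data a c s.

Lemma crit_s_bounds : 619 / 1000 <= s <= 64 / 100.
Proof.
have := rho_itv R; have := crit_data_s cd; rewrite ler_norml; lra.
Qed.

Lemma crit_quad1_bounds : - (65 / 100) <= b <= - (61 / 100).
Proof.
have := crit_s_bounds; have := crit_data_shifted2 cd.
by rewrite ler_norml /b /quad1; lra.
Qed.

Lemma crit_quad0_bounds : 385 / 1000 <= q <= 407 / 1000.
Proof.
have /andP[r1 r2] := rho_itv R; have := crit_data_quad0 cd.
have : (629 / 10 ^+ 3) ^+ 2 <= rho R ^+ 2 <= (63 / 100) ^+ 2.
  by apply: sqr_itv; lra.
by rewrite ler_norml -/q; lra.
Qed.

(** The roots of [u^2 + b u + q] are [- b / 2] plus or minus [i] times the square root of [disc]. *)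
Let disc := q - b ^+ 2 / 4.

Lemma crit_disc_bounds : (52 / 100) ^+ 2 <= disc <= (57 / 100) ^+ 2.
Proof.
have := crit_quad0_bounds; have := crit_quad1_bounds => /andP[b1 b2].
have : (61 / 100) ^+ 2 <= (- b) ^+ 2 <= (65 / 100) ^+ 2.
  by apply: sqr_itv; lra.
by rewrite sqrrN /disc; lra.
Qed.

Lemma crit_dist_cases (w : R[i]) : zeros (p_fam a)^`() w ->
  Normc.normc (a%:C%C - w) = s \/ Normc.normc (a%:C%C - w) = Num.sqrt q.
Proof.
have disc_gt0 : 0 < disc.
  by have /andP[+ _] := crit_disc_bounds; apply: lt_le_trans; lra.
have s_ge0 : 0 <= s by have := crit_s_bounds; lra.
rewrite -[w](subrKC a%:C%C) /zeros /= (crit_factor _ (crit_data_root cd)).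
rewrite normc_sub_shift; case: (w - _) => x y /orP[].
  rewrite eq_complex /= addr0 addr_eq0 => /andP[/eqP -> /eqP ->]; left.
  by rewrite sqrrN expr0n addr0 sqrtr_sqr ger0_norm.
rewrite -/c -/b -/q expr2 => /eqP[] /=; rewrite !(mul0r, mulr0, subr0, addr0).
move=> re0 im0; right; congr Num.sqrt.
(* This is the imaginary part of the equation. A real root is excluded by [disc > 0]; otherwise
   [b = - 2 x], and the real part says that [x^2 + y^2 = q]. *)
have : y * (2 * x + b) = 0 by rewrite -im0; ring.
move=> /eqP; rewrite mulf_eq0 => /orP[] /eqP y0.
  have : (x + b / 2) ^+ 2 + disc = 0.
    by rewrite -re0 y0 /disc; field.
  by have := sqr_ge0 (x + b / 2); move: disc_gt0; lra.
have bE : b = - (2 * x) by move: y0; lra.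
by move: re0; rewrite bE; lra.
Qed.

Lemma crit_point_real : zeros (p_fam a)^`() (a%:C%C + (- s)%:C%C).
Proof.
by rewrite /zeros /= (crit_factor _ (crit_data_root cd)) rmorphN addNr eqxx.
Qed.

(** The sign of [y] is left free so that both conjugate critical points are covered. *)
Lemma crit_point_nonreal (y : R) : y ^+ 2 = disc ->
  zeros (p_fam a)^`() (a%:C%C + Complex (- b / 2) y).
Proof.
move=> yE; rewrite /zeros /= (crit_factor _ (crit_data_root cd)).
rewrite -/c -/b -/q; apply/orP; right; rewrite eq_complex /=.
have qE : q = y ^+ 2 + b ^+ 2 / 4 by rewrite yE /disc; ring.
by rewrite qE; apply/andP; split; apply/eqP; field.
Qed.

Lemma crit_dist_p_fam :
  crit_dist (p_fam a) a%:C%C = Num.min s (Num.sqrt q).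
Proof.
have s_ge0 : 0 <= s by have := crit_s_bounds; lra.
have disc_ge0 : 0 <= disc.
  by have /andP[+ _] := crit_disc_bounds; apply: le_trans; lra.
apply/eqP; rewrite eq_le; apply/andP; split; last first.
  apply: crit_dist_ge; first by eexists; exact: crit_point_real.
  by move=> w /crit_dist_cases[] ->; rewrite ge_min lexx ?orbT.
rewrite le_min; apply/andP; split.
  apply: le_trans (crit_dist_le _ crit_point_real) _.
  by rewrite normc_sub_shift /= sqrrN expr0n addr0 sqrtr_sqr ger0_norm.
apply: le_trans (crit_dist_le _ (crit_point_nonreal (sqr_sqrtr disc_ge0))) _.
rewrite normc_sub_shift /= sqr_sqrtr// le_eqVlt; apply/orP; left; apply/eqP.
by congr Num.sqrt; rewrite /disc; field.
Qed.

(** The value 6/10 separates the zero [a], whose distance is near [r], about 0.63, from the other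
    zeros, which lie at distance about [1 - r], or 0.37, from some critical point. *)
Lemma crit_dist_p_fam_ge : 6 / 10 <= crit_dist (p_fam a) a%:C%C.
Proof.
have /andP[s1 _] := crit_s_bounds; have /andP[q1 _] := crit_quad0_bounds.
rewrite crit_dist_p_fam le_min; apply/andP; split; first lra.
have k0 : 0 <= 6 / 10 :> R by lra.
rewrite -[6 / 10](ger0_norm k0) -sqrtr_sqr ler_wsqrtr//; lra.
Qed.

Lemma crit_dist_N1_le : crit_dist (p_fam a) (-1) <= 6 / 10.
Proof.
apply: le_trans (crit_dist_le _ crit_point_real) _.
have := crit_s_bounds; have := crit_data_a cd => a_bd s_bd.
have -> : -1 - (a%:C%C + (- s)%:C%C) = Complex (- (1 + a - s)) 0.
  by apply/eqP; rewrite eq_complex /=; apply/andP; split; apply/eqP; ring.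
rewrite /= sqrrN expr0n addr0 sqrtr_sqr ger0_norm; lra.
Qed.

(** The condition [0 <= sn * y] pairs the zero with the critical point on its own side of the real
    axis, which treats [zeta a] and its conjugate together. *)
Lemma crit_dist_zeta_le (sn y : R) :
  sn ^+ 2 = 1 - c ^+ 2 -> y ^+ 2 = disc -> 0 <= sn * y ->
  crit_dist (p_fam a) (Complex c sn) <= 6 / 10.
Proof.
move=> snE yE sny.
apply: le_trans (crit_dist_le _ (crit_point_nonreal yE)) _.
have -> : Complex c sn - (a%:C%C + Complex (- b / 2) y)
    = Complex (c - a + b / 2) (sn - y).
  by apply/eqP; rewrite eq_complex /=; apply/andP; split; apply/eqP; field.
apply: normc_le; first lra.
have := crit_data_a cd; have := crit_data_c cd.
rewrite ler_norml -/c => c_bd a_bd.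
have := crit_quad1_bounds => b_bd.
have re_sq : 0 ^+ 2 <= (c - a + b / 2) ^+ 2 <= (21 / 100) ^+ 2.
  by apply: sqr_itv; lra.
have sn_bd : (85 / 100) ^+ 2 <= sn ^+ 2 <= (88 / 100) ^+ 2.
  have : (49 / 100) ^+ 2 <= c ^+ 2 <= (51 / 100) ^+ 2.
    by apply: sqr_itv; lra.
  by rewrite snE; lra.
have y_bd := crit_disc_bounds.
(* Only the squares of [sn] and [y] are bounded, so the bound is obtained for the squared product
   and the sign hypothesis removes the square. *)
have sny_ge : (85 / 100) * (52 / 100) <= sn * y.
  have : (85 / 100 * (52 / 100)) ^+ 2 <= (sn * y) ^+ 2.
    by rewrite !exprMn yE; apply: ler_pM; lra.
  by rewrite ler_sqr ?nnegrE; lra.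
have -> : (sn - y) ^+ 2 = sn ^+ 2 + disc - 2 * (sn * y) by rewrite -yE; ring.
lra.
Qed.

Lemma sendov_d_p_fam : 0 <= zeta_im a ->
  sendov_d (p_fam a) = crit_dist (p_fam a) a%:C%C.
Proof.
move=> im_ge0; have disc_ge0 : 0 <= disc.
  by have /andP[+ _] := crit_disc_bounds; apply: le_trans; lra.
apply: sendov_d_max => [|v].
  by rewrite /zeros /= p_fam_prod root_prod_XsubC !inE eqxx.
rewrite /zeros /= p_fam_prod root_prod_XsubC -p_fam_prod !inE.
move=> /or4P[] /eqP -> //; apply: le_trans crit_dist_p_fam_ge.
- exact: crit_dist_N1_le.
- apply: (@crit_dist_zeta_le _ (Num.sqrt disc)); first exact: zeta_im_sq.
    exact: sqr_sqrtr.
  by rewrite mulr_ge0 ?sqrtr_ge0.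
- apply: (@crit_dist_zeta_le _ (- Num.sqrt disc)); rewrite ?sqrrN ?sqr_sqrtr//.
    exact: zeta_im_sq.
  by rewrite mulrNN mulr_ge0 ?sqrtr_ge0.
Qed.
End crit_points.

(** * Conclusion *)

Lemma crit_dist_p_fam_near (R : realType) : exists2 K, 0 <= K &
  \forall a \near (0 : R)^'+,
    `|crit_dist (p_fam a) a%:C%C - (rho R + constC R * a ^+ 2)| <= K * a ^+ 3.
Proof.
have [K K0 dataK] := crit_data_near R; exists K => //.
apply: filterS dataK => a [s [cd sK qK]].
by rewrite (crit_dist_p_fam cd) /Num.min; case: ifP => _; [exact: sK|exact: qK].
Qed.

Lemma zeta_lipschitz_near (R : realType) : exists2 K, 0 <= K &
  \forall a \near (0 : R)^'+,
    `|zeta_re a - zeta_re 0| <= K * a /\ `|zeta_im a - zeta_im 0| <= K * a.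
Proof.
have [M dM] : near0_bounded (fun a => alpha1 R + alpha2 R * a).
  by near0_bounded_tac.
exists `|M| => //; near=> a.
have a0 : 0 < a by near: a; exact: nbhs_right_gt.
have da : `|alpha1 R + alpha2 R * a| <= M by near: a; exact: dM.
have angle : `|(pi / 3 + alpha1 R * a + alpha2 R * a ^+ 2)
    - (pi / 3 + alpha1 R * 0 + alpha2 R * 0 ^+ 2)| <= `|M| * a.
  rewrite (_ : _ - _ = (alpha1 R + alpha2 R * a) * a); last by ring.
  rewrite normrM (gtr0_norm a0) ler_pM2r//.
  by rewrite (le_trans da)// ler_norm.
by split; apply: le_trans angle; [exact: cos_lipschitz|exact: sin_lipschitz].
Unshelve. all: by end_near. Qed.

Lemma zeta_im_ge0_near (R : realType) :
  \forall a \near (0 : R)^'+, 0 <= zeta_im a.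
Proof.
have [K K0 zK] := zeta_lipschitz_near R.
have im0 : 1 / 2 <= zeta_im (0 : R).
  rewrite /zeta_im expr0n /= !mulr0 !addr0 sin_pi3 ler_pM2r ?invr_gt0//.
  by rewrite -[leLHS]sqrtr1 ler_wsqrtr// ler1n.
have Kb : near0_bounded (fun=> K) by exact: near0_bounded_cst.
have k0 : 0 < 1 / 2 :> R by lra.
near=> a.
have : `|a * K| <= 1 / 2 by near: a; exact: near0_bounded_small Kb k0.
have [_] :
    `|zeta_re a - zeta_re 0| <= K * a /\ `|zeta_im a - zeta_im 0| <= K * a.
  by near: a; exact: zK.
by move: im0; rewrite !ler_norml; lra.
Unshelve. all: by end_near. Qed.

Lemma root_dist_near (R : realType) : exists2 K, 0 < K &
  \forall a \near (0 : R)^'+, root_dist 4 (p_fam a) ('X^4 + 'X) <= K * a.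
Proof.
(* The real and imaginary parts of [zeta a] each move by at most [K a], and the zero [a] moves by
   [a] from 0. *)
have [K K0 zK] := zeta_lipschitz_near R; exists (2 * K + 1).
  by rewrite ltr_wpDl// mulr_ge0.
near=> a.
have a0 : 0 < a by near: a; exact: nbhs_right_gt.
have [reK imK] :
    `|zeta_re a - zeta_re 0| <= K * a /\ `|zeta_im a - zeta_im 0| <= K * a.
  by near: a; exact: zK.
have Ka : 0 <= K * a by rewrite mulr_ge0// ltW.
have norm_le (x y : R) : `|x| <= K * a -> `|y| <= K * a ->
    Normc.normc (Complex x y) <= (2 * K + 1) * a.
  by move=> xK yK; rewrite (le_trans (normc_le_ReIm _ _))//; lra.
(* Since [z^4 + z] is the member of the family at 0, the zeros are paired in the order in which the
   family lists them. *)
rewrite -p_fam0 2!p_fam_prod.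
apply: (@root_dist_le _ 4 [tuple _; _; _; _] [tuple _; _; _; _]).
  by rewrite mulr_ge0// ?ltW// ltr_wpDl// mulr_ge0.
move=> i; rewrite !(tnth_nth 0); case: i => -[|[|[|[|//]]]] /= _.
- rewrite oppr0 !addr0 expr0n addr0 sqrtr_sqr gtr0_norm//; lra.
- rewrite !subrr expr0n addr0 sqrtr0; lra.
- exact: norm_le.
- apply: norm_le => //.
  by rewrite -opprD normrN.
Unshelve. all: by end_near. Qed.

(** The critical points are the cube roots of [-1/4]. The zero 0 is at distance [r] from [- r], and
    a zero [z] with [z^3 = -1] is at distance [1 - r < r] from [r z]. *)
Lemma sendov_d_X4X (R : realType) : sendov_d ('X^4 + 'X : {poly R[i]}) <= rho R.
Proof.
have r0 := rho_gt0 R.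
have r0' := ltW r0.
have dE (w : R[i]) : ('X^4 + 'X : {poly R[i]})^`().[w] = 4 * w ^+ 3 + 1.
  by rewrite derivD derivXn derivX /= hornerD hornerMn hornerXn hornerC
    mulr_natl.
have rho3 : 4 * (rho R)%:C%C ^+ 3 = 1 :> R[i].
  by rewrite -rmorphXn rho_cubed; field.
apply: sendov_d_le => [|z].
  by exists 0; rewrite /zeros /= rootE hornerD hornerXn hornerX expr0n addr0.
rewrite /zeros /= rootE hornerD hornerXn hornerX.
have -> : z ^+ 4 + z = z * (z ^+ 3 + 1) by ring.
rewrite mulf_eq0 => /orP[/eqP ->|/eqP z3].
  have cw : zeros ('X^4 + 'X)^`() (- (rho R)%:C%C).
    by apply/eqP; rewrite dE exprNn -signr_odd /= expr1 mulN1r mulrN rho3 addNr.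
  apply: le_trans (crit_dist_le 0 cw) _.
  by rewrite sub0r opprK /= expr0n addr0 sqrtr_sqr ger0_norm.
have {}z3 : z ^+ 3 = -1 by apply/eqP; rewrite -addr_eq0 z3.
have norm_z : Normc.normc z = 1.
  have : Normc.normc z ^+ 3 = 1.
    rewrite exprS expr2 -!Normc.normcM -expr2 -exprS z3 normcN.
    exact: Normc.normc1.
  by move/eqP; rewrite pexpr_eq1 ?normc_ge0// => /eqP.
have cw : zeros ('X^4 + 'X)^`() ((rho R)%:C%C * z).
  by apply/eqP; rewrite dE exprMn z3 mulrN1 mulrN rho3 addNr.
apply: le_trans (crit_dist_le z cw) _.
have -> : z - (rho R)%:C%C * z = (1 - rho R)%:C%C * z.
  by rewrite rmorphB /= mulrBl mul1r.
have /andP[r1 r2] := rho_itv R.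
rewrite Normc.normcM norm_z mulr1 /= expr0n addr0 sqrtr_sqr ger0_norm; lra.
Qed.

Theorem theorem7 (R : realType) :
  (forall a : R, 0 <= a <= 1 -> S_class 4 (p_fam a)) /\
  (fun a : R => root_dist 4 (p_fam a) ('X^4 + 'X) : R^o)
    =O_ (0^'+) (fun a : R => a : R^o) /\
  (\forall a \near (0 : R)^'+,
     sendov_d (p_fam a) = crit_dist (p_fam a) a%:C%C) /\
  ((fun a : R => crit_dist (p_fam a) a%:C%C : R^o) =
     (fun a : R => rho R + constC R * a ^+ 2 : R^o)
       +O_ (0^'+) (fun a : R => a ^+ 3 : R^o)) /\
  `|constC R - (10 + 811 / 10 ^+ 3 + 549 / 10 ^+ 6 + 38 / 10 ^+ 8)|
    < 1 / 10 ^+ 7 /\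
  S_class 4 ('X^4 + 'X : {poly R[i]}) /\
  ~ locally_maximal 4 ('X^4 + 'X : {poly R[i]}).
Proof.
have [K K0 rootK] := root_dist_near R.
have [M M0 critM] := crit_dist_p_fam_near R.
have sendovE : \forall a \near (0 : R)^'+,
    sendov_d (p_fam a) = crit_dist (p_fam a) a%:C%C.
  have [L _ dataL] := crit_data_near R.
  apply: filterS2 (zeta_im_ge0_near R) dataL => a im_ge0 [s [cd _ _]].
  exact: sendov_d_p_fam cd im_ge0.
split; first exact: S_class_p_fam.
split.
  apply/eqO_exP; exists K => //.
  near=> a; have a0 : 0 < a by near: a; exact: nbhs_right_gt.
  rewrite (ger0_norm (root_dist_ge0 _ _ _)) (gtr0_norm a0).
  by near: a; exact: rootK.
split => //.
split.
  (* The constant has to be positive, while [M] is only known to be nonnegative. *)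
  apply/eqaddOP/bigO_exP; exists (M + 1); first by rewrite ltr_wpDl.
  near=> a; have a0 : 0 < a by near: a; exact: nbhs_right_gt.
  have a30 : 0 < a ^+ 3 by rewrite exprn_gt0.
  rewrite [X in _ <= _ * X](gtr0_norm a30).
  apply: (@le_trans _ _ (M * a ^+ 3)); last by rewrite ler_pM2r// lerDl.
  by near: a; exact: critM.
split; first exact: constC_bounds.
split; first by rewrite -p_fam0; apply: S_class_p_fam; rewrite lexx ler01.
move=> [eps eps0 max].
have Kb : near0_bounded (fun=> K) by exact: near0_bounded_cst.
have Mb : near0_bounded (fun=> M) by exact: near0_bounded_cst.
have C0 : 0 < constC R by have := constC_bounds R; rewrite ltr_norml; lra.
have eps20 : 0 < eps / 2 by lra.
have C20 : 0 < constC R / 2 by lra.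
(* For small [a] the polynomial [p_fam a] is within [eps] of [z^4 + z], so local maximality would
   give [d(p_a) <= r]. Yet [d(p_a) >= r + C a^2 - M a^3], which exceeds [r] as soon as
   [a M <= C / 2]. *)
near ((0 : R)^'+) => a.
have a0 : 0 < a by near: a; exact: nbhs_right_gt.
have a1 : a <= 1 by near: a; exact: nbhs_right_le.
have : sendov_d (p_fam a) <= rho R.
  apply: le_trans (sendov_d_X4X R); apply: max.
    by apply: S_class_p_fam; rewrite ltW.
  apply: (@le_lt_trans _ _ (K * a)); first by near: a; exact: rootK.
  rewrite mulrC (le_lt_trans (ler_norm _))//.
  apply: (@le_lt_trans _ _ (eps / 2)); last lra.
  by near: a; exact: near0_bounded_small Kb eps20.
have -> : sendov_d (p_fam a) = crit_dist (p_fam a) a%:C%C.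
  by near: a; exact: sendovE.
apply/negP; rewrite -ltNge.
have : `|crit_dist (p_fam a) a%:C%C - (rho R + constC R * a ^+ 2)|
    <= M * a ^+ 3.
  by near: a; exact: critM.
have aM : `|a * M| <= constC R / 2.
  by near: a; exact: near0_bounded_small Mb C20.
have a2 : 0 < a ^+ 2 by rewrite exprn_gt0.
have : M * a ^+ 3 < constC R * a ^+ 2.
  rewrite (_ : M * a ^+ 3 = a * M * a ^+ 2); last by ring.
  by rewrite ltr_pM2r// (le_lt_trans (ler_norm _))// (le_lt_trans aM)//; lra.
by rewrite ler_norml; lra.
Unshelve. all: by end_near. Qed.
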